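(* Let $(X,d)$ be a uniformly perfect metric space. If $(\alpha_n)_{n=1}^\infty\in\ell^0$ and $E\subset X$ is $(\alpha_n)$-thick, then $E$ is fat.
   Context: $B(x,r)=\{y\in X: d(x,y)\le r\}$ denotes the closed ball with center $x$ and radius $r$; $\mathbb{N}=\{1,2,\ldots\}$. A metric space $X$ is uniformly perfect (with constant $D$) if it is not a singleton and there is a constant $D\ge 1$ such that for all $x\in X$ and $r>0$: $X\setminus B(x,r)\ne\emptyset$ implies $B(x,r)\setminus B(x,r/D)\neq\emptyset$. A (Borel regular outer) measure $\mu$ on a metric space $(X,d)$ is doubling if there is a constant $C\ge 1$ depending only on $\mu$ such that $0<\mu(B(x,2r))\le C\mu(B(x,r))<\infty$ for all $x\in X$ and $r>0$. A set $A\subset X$ is fat if $\mu(A)>0$ for every doubling measure $\mu$ on $X$. For $p>0$, $\ell^p:=\{(\alpha_n)_{n=1}^\infty : 0<\alpha_n<1 \text{ and } \sum_{n=1}^\infty \alpha_n^p<\infty\}$, and $\ell^0:=\bigcap_{p>0}\ell^p$. A set $E\subset X$ is $(\alpha_n)$-thick, for a sequence $0<\alpha_n<1$, if there exist constants $N\in\mathbb{N}$, $0<c\le 1$ and finite or countable collections of Borel sets $\mathcal{I}_n=\{I_{n,j}\subset X\}$ and $\mathcal{J}_n=\{J_{n,j}\subset I_{n,j}\}$ for all $n\in\mathbb{N}$ with the properties: (i) $E_0=\bigcup_{n\in\mathbb{N}}\bigcup_{I\in\mathcal{I}_n} I$ is bounded; (ii) for all $n\in\mathbb{N}$, each $x\in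 X$ belongs to at most $N$ different sets $I_{n,j}$; (iii) $c\operatorname{diam}(J_{n,j})\le\alpha_n\operatorname{diam}(I_{n,j})$ holds for all $J_{n,j}$; (iv) for all $I_{n,j}$ there exists some $x_{n,j}\in I_{n,j}$ so that $B(x_{n,j},\delta_{n,j})\subset I_{n,j}\setminus\bigcup_{k=1}^{n-1}\bigcup_i J_{k,i}$, where $0<\delta_{n,j}=c\operatorname{diam}(I_{n,j})$; (v) $E_0\setminus\bigcup_{n=1}^\infty\bigcup_j J_{n,j}\subset E$.
   Formalization: Each collection I_n is required to be nonempty (if all were empty, E = ∅ would be thick but not fat), and the overlap bound N in (ii) counts indices j, so repeated sets I_{n,j} count with multiplicity. *)

(* Defs.v *)
From HB Require Import structures.
From mathcomp Require Import all_boot all_order all_algebra.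
From mathcomp Require Import all_classical all_reals all_analysis.

Set Implicit Arguments.
Unset Strict Implicit.
Unset Printing Implicit Defensive.

Import Order.TTheory GRing.Theory Num.Theory.
Import numFieldNormedType.Exports.

Local Open Scope classical_set_scope.
Local Open Scope ring_scope.

Section MetricNotions.
Context {R : realType} {X : metricType R}.

(* Not the library's [closed_ball], which is the closure of the open ball and
   may be strictly smaller in a general metric space. *)
Definition cball (x : X) (r : R) : set X := [set y | mdist x y <= r].

Definition mbounded (A : set X) : Prop :=
  exists M : R, forall x y, A x -> A y -> mdist x y <= M.

(* As [sup] is real-valued, this is the diameter only for bounded [A] (with
   value 0 on [set0]); below it is applied to subsets of a bounded set only. *)
Definition diam (A : set X) : R := sup [set mdist z.1 z.2 | z in A `*` A].

Definition borel_set (A : set X) : Prop := <<s [set U : set X | open U] >> A.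

Definition borel_regular (mu : {outer_measure set X -> \bar R}) : Prop :=
  (forall B, borel_set B -> mu.-caratheodory B) /\
  (forall A : set X, exists B, [/\ borel_set B, A `<=` B & mu B = mu A]).

Definition doubling (mu : {outer_measure set X -> \bar R}) : Prop :=
  exists C : R, 1 <= C /\
    forall (x : X) (r : R), 0 < r ->
      [/\ (0 < mu (cball x (2 * r)))%E,
          (mu (cball x (2 * r)) <= C%:E * mu (cball x r))%E
        & (C%:E * mu (cball x r) < +oo)%E].

Definition fat (A : set X) : Prop :=
  forall mu : {outer_measure set X -> \bar R},
    borel_regular mu -> doubling mu -> (0 < mu A)%E.

(* Sequences are indexed from 0: [alpha n], [I n], [J n] stand for the objects
   of index n + 1 in the usual numbering from 1.  The n-th collections are the
   families [I n j], [J n j] with [j] in the nonempty, finite or countable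
   index set [K n]; [I n j] and [J n j] are irrelevant for [j] outside [K n].
   The overlap bound counts indices [j], so repeated sets [I n j] count with
   their multiplicity. *)
Definition thick (alpha : R^nat) (E : set X) : Prop :=
  exists (N : nat) (c : R) (K : nat -> set nat) (I J : nat -> nat -> set X),
  let E0 := \bigcup_n \bigcup_(j in K n) I n j in
  [/\ (0 < N)%N, 0 < c <= 1, forall n, K n !=set0
    & forall n j, K n j ->
        [/\ borel_set (I n j), borel_set (J n j) & J n j `<=` I n j]] /\
  [/\ mbounded E0,
      forall n (x : X), ([set j | K n j /\ I n j x] #<= `I_N)%card,
      forall n j, K n j -> c * diam (J n j) <= alpha n * diam (I n j),
      forall n j, K n j ->
        let delta := c * diam (I n j) in
        0 < delta /\
        exists x, I n j x /\
          cball x delta `<=`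
            I n j `\` \bigcup_(k < n) \bigcup_(i in K k) J k i
    & E0 `\` \bigcup_n \bigcup_(j in K n) J n j `<=` E].

End MetricNotions.

Definition uniformly_perfect {R : realType} (X : metricType R) : Prop :=
  ~ (exists x : X, [set: X] = [set x]) /\
  exists D : R, 1 <= D /\
    forall (x : X) (r : R), 0 < r ->
      [set: X] `\` cball x r !=set0 ->
      cball x r `\` cball x (r / D) !=set0.

Definition ell {R : realType} (p : R) : set (R^nat) :=
  [set alpha | (forall n, 0 < alpha n < 1) /\
               (\sum_(0 <= n <oo) (alpha n `^ p)%:E < +oo)%E].

Definition ell0 {R : realType} : set (R^nat) :=
  \bigcap_(p in [set p : R | 0 < p]) ell p.

(* Main.v *)
(** Uniform perfectness makes a doubling measure reverse doubling, so that
    [mu J <= C alpha_n^s mu B], for some [s > 0], when [J] has diameter at most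
    [(alpha_n / c) diam I] inside [I] and [B] is the ball of radius [c diam I]
    given by (iv).  Let [A_n] be [E0] without all [J_k] for [k < n].  The balls
    at step [m >= n] lie in [A_n] and overlap at most [N] times, so the union of
    the [J_(m,j)] has measure at most [C N alpha_m^s mu A_n].  If [mu E = 0],
    then for [n] large [mu A_n <= C N (sum_(m >= n) alpha_m^s) mu A_n <=
    mu A_n / 2], whereas [A_n] contains a ball and is bounded. *)

Require Import Defs.
From mathcomp Require Import all_boot all_order all_algebra.
From mathcomp Require Import all_classical all_reals all_analysis.
From mathcomp Require Import ring lra.

Import Order.TTheory GRing.Theory Num.Theory.

Local Open Scope classical_set_scope.
Local Open Scope ring_scope.

(** * Families of sets with bounded overlap *)

(** Turns the overlap bound (ii), a cardinality, into a count along a list, on which one can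
    induct. *)
Lemma count_asbool_card_le (P : nat -> Prop) (s : seq nat) (N : nat) :
  uniq s -> ([set j | P j] #<= `I_N)%card ->
  (count (fun j => `[< P j >]) s <= N)%N.
Proof.
move=> us PN; rewrite -size_filter.
set t := seq.filter _ s.
have ut : uniq t by exact: filter_uniq.
rewrite -card_le_II.
have tI : {in `I_(size t) &, injective (nth 0%N t)}.
  by move=> i j; rewrite !inE /= => it jt /eqP; rewrite nth_uniq// => /eqP.
have tP : nth 0%N t @` `I_(size t) `<=` [set j | P j].
  move=> _ [i it <-] /=.
  by have := mem_nth 0%N it; rewrite mem_filter => /andP[/asboolP].
apply: card_le_trans PN; apply: card_le_trans (subset_card_le tP).
by rewrite (card_le_eqr (inj_card_eq tI)).
Qed.

Section OuterMeasure.
Context {R : realType} {T : Type} (mu : {outer_measure set T -> \bar R}).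
Local Open Scope ereal_scope.

(** Induction on [s], cutting [A] along the head set [B i]. Outside [B i] the bound [N] persists;
    inside, the tail has overlap at most [N - 1], which leaves room for the head term
    [mu (A]&[B i)]. *)
Lemma sum_caratheodory_overlap (B : nat -> set T) (s : seq nat) (N : nat)
    (A : set T) :
  (forall j, mu.-caratheodory (B j)) ->
  (forall x, A x -> (count (fun j => `[< B j x >]) s <= N)%N) ->
  \sum_(j <- s) mu (A `&` B j) <= N%:R%:E * mu A.
Proof.
move=> Bc; elim: s N A => [|i s IH] N A AN.
  by rewrite big_nil mule_ge0 ?outer_measure_ge0 ?lee_fin.
rewrite big_cons.
have -> : \sum_(j <- s) mu (A `&` B j) =
    \sum_(j <- s) mu ((A `&` B i) `&` B j) +
    \sum_(j <- s) mu ((A `&` ~` B i) `&` B j).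
  rewrite -big_split/=; apply: eq_bigr => j _.
  by rewrite [LHS](Bc i) setIAC [X in mu X + _]setIC setIAC setIC.
have AC : \sum_(j <- s) mu ((A `&` ~` B i) `&` B j) <=
    N%:R%:E * mu (A `&` ~` B i).
  apply: IH => x [Ax nBx]; apply: leq_trans (AN x Ax).
  by rewrite /= leq_addl.
rewrite (Bc i A) ge0_muleDr ?outer_measure_ge0// addeA leeD//.
have [AB0|/set0P[x [Ax Bx]]] := eqVneq (A `&` B i) set0.
  rewrite AB0 outer_measure0 mule0 add0e.
  by rewrite big1// => j _; rewrite set0I outer_measure0.
case: N AN {AC} => [|N] AN.
  by have := AN x Ax; rewrite /= asboolT.
rewrite -natr1 EFinD ge0_muleDl ?lee_fin//.
rewrite mul1e addeC leeD//; apply: IH => y [Ay By].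
by have := AN y Ay; rewrite /= asboolT//.
Qed.

(** By countable subadditivity it suffices to bound the partial sums of [mu (B j)], where [B j]
    equals its trace on [A]. *)
Lemma le_outer_measure_bigcup_overlap (J B : nat -> set T) (A : set T)
    (k : R) (N : nat) :
  (0 <= k)%R ->
  (forall j, [/\ mu.-caratheodory (B j), B j `<=` A &
                 mu (J j) <= k%:E * mu (B j)]) ->
  (forall x, ([set j | B j x] #<= `I_N)%card) ->
  mu (\bigcup_j J j) <= (k * N%:R)%:E * mu A.
Proof.
move=> k0 BJ BN.
apply: (le_trans (outer_measure_sigma_subadditive mu J)).
apply: (@le_trans _ _ (\sum_(0 <= j <oo) k%:E * mu (B j))).
  apply: lee_nneseries => [j _ _|j _]; first exact: outer_measure_ge0.
  by case: (BJ j).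
rewrite nneseriesZl => [|j _]; last exact: outer_measure_ge0.
rewrite EFinM -muleA; apply: lee_wpmul2l; first by rewrite lee_fin.
apply: lime_le.
  by apply: is_cvg_nneseries => j _ _; exact: outer_measure_ge0.
apply: nearW => n.
rewrite (eq_bigr (fun j => mu (A `&` B j))) => [|j _]; last first.
  by rewrite setIidr//; case: (BJ j).
apply: sum_caratheodory_overlap => [j|x _]; first by case: (BJ j).
exact: count_asbool_card_le (iota_uniq _ _) (BN x).
Qed.

End OuterMeasure.

(** * Terms and tails of convergent series *)

Section Series.
Context {R : realType}.
Local Open Scope ereal_scope.

Lemma nneseries_tail_lt (f : R^nat) (e : R) :
  (forall n, 0 <= f n)%R -> \sum_(0 <= n <oo) (f n)%:E < +oo -> (0 < e)%R ->
  \forall n \near \oo, \sum_(n <= i <oo) (f i)%:E < e%:E.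
Proof.
move=> f0 foo e0.
have ft : \sum_(n <= i <oo) (f i)%:E @[n --> \oo] --> 0%:E.
  by apply: nneseries_tail_cvg foo _ => i _; rewrite lee_fin.
apply: (ft [set y | y < e%:E]).
apply/nbhs_EFin; near=> y; rewrite /= lte_fin.
by near: y; exact: lt_nbhsl.
Unshelve. all: by end_near. Qed.

Lemma nneseries_near_lt (f : R^nat) (e : R) :
  (forall n, 0 <= f n)%R -> \sum_(0 <= n <oo) (f n)%:E < +oo -> (0 < e)%R ->
  \forall n \near \oo, (f n < e)%R.
Proof.
move=> f0 foo e0; near=> n.
rewrite -lte_fin; apply: (@le_lt_trans _ _ (\sum_(n <= i <oo) (f i)%:E)).
  rewrite -[leLHS](big_nat1 +%E n (fun i => (f i)%:E)).
  by apply: nneseries_lim_ge => i _ _; rewrite lee_fin.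
by near: n; exact: nneseries_tail_lt.
Unshelve. all: by end_near. Qed.

End Series.


(** * Balls, diameters and doubling measures *)

Section Doubling.
Context {R : realType} {X : metricType R}.
Implicit Types (x y z : X) (r s t : R).

Lemma sub_cball x y r s : mdist x y + r <= s -> cball y r `<=` cball x s.
Proof.
rewrite /cball => h z /= yz.
by rewrite (le_trans (metric_triangle x y z))// (le_trans _ h)// lerD2l.
Qed.

Lemma mdist_le_diam (A : set X) x y :
  mbounded A -> A x -> A y -> mdist x y <= diam A.
Proof.
move=> [M AM] Ax Ay; apply: ub_le_sup; last by exists (x, y).
by exists M => _ [[u v] [/= Au Av] <-]; exact: AM.
Qed.

Lemma diam_le (A : set X) r : A !=set0 ->
  (forall x y, A x -> A y -> mdist x y <= r) -> diam A <= r.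
Proof.
move=> [x Ax] Ar; apply: ge_sup; first by exists (mdist x x), (x, x).
by move=> _ [[u v] [/= Au Av] <-]; exact: Ar.
Qed.

Lemma borel_set_cball x r : borel_set (cball x r).
Proof.
rewrite -[cball x r]setCK -setTD; apply: sigma_algebraCD.
apply: sub_sigma_algebra => /=.
rewrite openE => y /= /negP; rewrite -ltNge => xy.
rewrite /interior -nbhs_ballE; exists (mdist x y - r) => /=.
  by rewrite subr_gt0.
move=> z; rewrite ballEmdist /cball /= => yz xz.
have := metric_triangle x z y; rewrite (metric_sym z y).
by apply/negP; rewrite -ltNge; lra.
Qed.

Variable mu : {outer_measure set X -> \bar R}.
Hypothesis mudbl : doubling mu.
Local Open Scope ereal_scope.

Lemma doubling_gt0 x r : (0 < r)%R -> 0 < mu (cball x r).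
Proof.
case: mudbl => C [C1 H] r0.
have [|+ _ _] := H x (r / 2)%R; first by rewrite divr_gt0.
by rewrite mulrC divfK.
Qed.

Lemma doubling_fin_num x r : mu (cball x r) \is a fin_num.
Proof.
case: mudbl => C [C1 H].
(* Doubling speaks of positive radii only; [t] also covers [r <= 0]. *)
set t := Num.max 1%R r.
have t0 : (0 < t)%R by rewrite lt_max ltr01.
have [_ _ tfin] := H x t t0.
rewrite ge0_fin_numE ?outer_measure_ge0//; apply: le_lt_trans tfin.
apply: (@le_trans _ _ (mu (cball x t))).
  by apply/le_outer_measure/sub_cball; rewrite mdistxx add0r le_max lexx orbT.
by rewrite lee_pemull ?outer_measure_ge0.
Qed.

(** Iterates doubling [m] times, where [L <= 2 ^ m]. *)
Lemma doubling_scale (L : R) : exists k : R, (0 < k)%R /\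
  forall x r, (0 < r)%R -> mu (cball x (L * r)) <= k%:E * mu (cball x r).
Proof.
case: mudbl => C [C1 H].
have C0 : (0 < C)%R by rewrite (lt_le_trans ltr01).
have HX m x r : (0 < r)%R ->
    mu (cball x (2 ^+ m * r)) <= (C ^+ m)%:E * mu (cball x r).
  elim: m r => [|m IH] r r0; first by rewrite !expr0 mul1r mul1e.
  rewrite exprSr -mulrA (le_trans (IH _ _))// ?mulr_gt0//.
  rewrite exprSr EFinM -muleA lee_pmul2l// ?lte_fin ?exprn_gt0//.
  by case: (H x _ r0).
have [m Lm] : exists m, (L <= 2 ^+ m)%R.
  exists (Num.truncn `|L|).+1.
  rewrite (le_trans (ler_norm _))// ltW//.
  apply: (lt_trans (truncnS_gt _)).
  by rewrite -natrX ltr_nat ltn_expl.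
exists (C ^+ m)%R; split; first by rewrite exprn_gt0.
move=> x r r0; apply: le_trans (HX m x r r0).
by apply/le_outer_measure/sub_cball; rewrite mdistxx add0r ler_pM2r.
Qed.


(** * Power decay of the measure of balls in a uniformly perfect space *)

Hypothesis muB : forall x r, mu.-caratheodory (cball x r).
Hypothesis upX : uniformly_perfect X.

(* If [z] lies in [cball y (r / 2)] but not in [cball y (r / (2 * D))], the
   balls of radius [r / (4 * D)] around [y] and [z] are disjoint subsets of
   [cball y r] of comparable measure. *)
Lemma reverse_doubling : exists q L : R, [/\ (0 < q < 1)%R, (2 <= L)%R &
  forall y r, (0 < r)%R -> ~` cball y (r / 2) !=set0 ->
    mu (cball y (r / L)) <= q%:E * mu (cball y r)].
Proof.
have [_ [D [D1 HD]]] := upX.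
have D0 : (0 < D)%R by lra.
have [k [k0 Hk]] := doubling_scale (4 * D).
(* With [e = r / (4 * D)], doubling at [z] makes the [e]-ball at [y] at most [k] times that at [z];
   their sum is at most [mu (cball y r)], whence the ratio [k / (1 + k)]. *)
exists (k / (1 + k))%R, (4 * D)%R; split.
- by rewrite divr_gt0 ?ltr_pdivrMr//=; lra.
- by lra.
move=> y r r0 ry.
have [|z [yz yzD]] := HD y (r / 2)%R ltac:(lra).
  by rewrite setTD.
set e := (r / (4 * D))%R.
have eD : (r / 2 / D = e + e)%R by rewrite /e; field; lra.
have eM : (4 * D * e = r)%R by rewrite /e; field; lra.
have e0 : (0 < e)%R by rewrite divr_gt0//; lra.
have er : (e <= r / 4)%R by nra.
move: yz yzD; rewrite /cball/= eD => yz /negP; rewrite -ltNge => yzD.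
have ye_z : cball y e `<=` cball z (4 * D * e).
  by apply: sub_cball; rewrite metric_sym eM; lra.
have ye_y : cball y e `<=` cball y r.
  by apply: sub_cball; rewrite mdistxx; lra.
have ze_y : cball z e `<=` cball y r by apply: sub_cball; lra.
have ze_ye : cball z e `<=` ~` cball y e.
  move=> w; rewrite /cball/= => zw yw.
  have := metric_triangle y w z; rewrite (metric_sym w z); lra.
have le1 : mu (cball y e) <= k%:E * mu (cball z e).
  exact: le_trans (le_outer_measure _ _ _ ye_z) (Hk _ _ e0).
have le2 : mu (cball y e) + mu (cball z e) <= mu (cball y r).
  rewrite [leRHS](muB y e) setIidr// leeD2l// le_outer_measure//.
  by rewrite subsetI.
move: le1 le2.
rewrite -(fineK (doubling_fin_num y e)) -(fineK (doubling_fin_num z e)).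
rewrite -(fineK (doubling_fin_num y r)) -!EFinM -EFinD !lee_fin => le1 le2.
by rewrite mulrAC ler_pdivlMr; nra.
Qed.

(** Reverse doubling is iterated [n] times, where [L^-1 ^+ n.+1 < u <= L^-1 ^+ n]. The exponent [s]
    solves [L^-1]^ s = q[, so]q ^+ n.+1 <= u [^ s]; the constant [q^-1] pays for the extra factor
    [q]. *)
Lemma uniformly_perfect_doubling_decay : exists s k : R,
  [/\ (0 < s)%R, (0 < k)%R & forall y r u, (0 < r)%R -> (0 < u <= 1)%R ->
    ~` cball y (r / 2) !=set0 ->
    mu (cball y (u * r)) <= (k * u `^ s)%:E * mu (cball y r)].
Proof.
have [q [L [/andP[q0 q1] L2 qL]]] := reverse_doubling.
have L0 : (0 < L)%R by lra.
have Li0 : (0 < L^-1)%R by rewrite invr_gt0.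
have Li1 : (L^-1 < 1)%R by rewrite invf_lt1//; lra.
have lnL : (ln L^-1 < 0)%R by rewrite ln_lt0// Li0.
have lnq : (ln q < 0)%R by rewrite ln_lt0// q0.
exists (ln q / ln L^-1)%R, q^-1%R; split.
- by rewrite nmulr_lgt0// invr_lt0.
- by rewrite invr_gt0.
set s := (ln q / ln L^-1)%R.
have Ls n : ((L^-1 ^+ n) `^ s = q ^+ n)%R.
  rewrite -(powR_mulrn n (ltW Li0)) -powRrM [(n%:R * s)%R]mulrC powRrM.
  rewrite [(L^-1 `^ s)%R]/powR gt_eqF// divfK ?lt_eqF// lnK ?posrE//.
  exact: powR_mulrn (ltW q0).
have iter y r n : (0 < r)%R -> ~` cball y (r / 2) !=set0 ->
    mu (cball y (L^-1 ^+ n * r)) <= (q ^+ n)%:E * mu (cball y r).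
  move=> r0 [w yw]; elim: n => [|n IH]; first by rewrite !expr0 mul1r mul1e.
  rewrite exprS -mulrA [X in cball y X]mulrC.
  have Ln1 : (L^-1 ^+ n <= 1)%R by rewrite exprn_ile1// ltW.
  have Ln0 : (0 < L^-1 ^+ n)%R by rewrite exprn_gt0.
  apply: le_trans (qL _ _ _ _) _.
  - by rewrite mulr_gt0.
  (* A point outside the ball of radius [r / 2] is also outside the smaller ones. *)
  - exists w => yw'; apply: yw; move: w yw'; apply: sub_cball.
    by rewrite mdistxx; nra.
  - by rewrite exprS EFinM -muleA lee_pmul2l// lte_fin.
move=> y r u r0 /andP[u0 u1] yr.
have exn : exists n, (L^-1 ^+ n.+1 < u)%R.
  exists (Num.truncn u^-1); set n := Num.truncn _.
  rewrite exprVn -[ltRHS]invrK ltf_pV2 ?posrE ?exprn_gt0 ?invr_gt0//.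
  apply: lt_le_trans (truncnS_gt _) _; rewrite -/n.
  apply: (@le_trans _ _ (2 ^+ n.+1)%R).
    by rewrite -natrX ler_nat ltnW// ltn_expl.
  by rewrite lerXn2r// nnegrE; lra.
case: (ex_minnP exn) => n un nmin.
have {nmin} nu : (u <= L^-1 ^+ n)%R.
  case: n un nmin => [|n] _ nmin; first by rewrite expr0.
  by rewrite leNgt; apply/negP => /nmin; rewrite ltnn.
apply: (@le_trans _ _ (mu (cball y (L^-1 ^+ n * r)))).
  by apply/le_outer_measure/sub_cball; rewrite mdistxx add0r ler_pM2r.
apply: le_trans (iter y r n r0 yr) _.
rewrite lee_wpmul2r ?outer_measure_ge0// lee_fin mulrC ler_pdivlMr// -exprSr.
rewrite -Ls ge0_ler_powR ?nnegrE ?exprn_ge0 ?ltW//.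
by rewrite nmulr_lgt0// invr_lt0.
Qed.

(** Let [d = diam I] and [y] in [J]. Then [J] lies in the ball at [y] of radius [2 * t] times
    [d / 2], to which decay applies as [2 * t <= 1]. The ball of radius [d / 2] at [y] lies in that
    of radius [2 * d] at [x], comparable by doubling to that of radius [c * d]. *)
Lemma small_subset_measure (c : R) : (0 < c)%R -> exists s k : R,
  [/\ (0 < s)%R, (0 < k)%R & forall (I J : set X) (x : X) (t : R),
    mbounded I -> (0 < diam I)%R -> I x -> J `<=` I ->
    (0 < t)%R -> (2 * t <= 1)%R -> (diam J <= t * diam I)%R ->
    mu J <= (k * t `^ s)%:E * mu (cball x (c * diam I))].
Proof.
move=> c0.
have [s [k [s0 k0 Hk]]] := uniformly_perfect_doubling_decay.
have [k' [k'0 Hk']] := doubling_scale (2 / c).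
exists s, (k * 2 `^ s * k')%R; split=> //.
  by rewrite !mulr_gt0// powR_gt0.
move=> I J x t Ib I0 Ix JI t0 t1 Jt.
have [->|/set0P[y Jy]] := eqVneq J set0.
  rewrite outer_measure0 mule_ge0 ?outer_measure_ge0// lee_fin.
  by rewrite !mulr_ge0 ?powR_ge0// ltW.
set d := diam I in I0 Jt *.
have Iy := JI _ Jy.
have Jb : mbounded J by case: Ib => M IM; exists M => u v /JI ? /JI; exact: IM.
have Jball : J `<=` cball y (2 * t * (d / 2)).
  move=> z Jz; rewrite /cball/=.
  have -> : (2 * t * (d / 2) = t * d)%R by field.
  exact: le_trans (mdist_le_diam _ _ _ Jb Jy Jz) Jt.
(* If the ball of radius [d / 4] were the whole space, [I] would have diameter at most [d / 2]. *)
have ynonfull : ~` cball y (d / 2 / 2) !=set0.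
  apply/set0P/eqP => yX; suff : (d <= d / 2)%R by lra.
  have {yX} yX w : cball y (d / 2 / 2) w.
    by apply: contrapT => yw; have : set0 w by rewrite -yX.
  apply: diam_le => [|u v _ _]; first by exists x.
  apply: le_trans (metric_triangle u y v) _.
  by have := yX u; have := yX v; rewrite /cball/= (metric_sym u y); lra.
have xy : cball y (d / 2) `<=` cball x (2 / c * (c * d)).
  apply: sub_cball; have := mdist_le_diam _ _ _ Ib Ix Iy; rewrite -/d.
  have -> : (2 / c * (c * d) = 2 * d)%R by field; lra.
  by lra.
apply: le_trans (le_outer_measure _ _ _ Jball) _.
have d20 : (0 < d / 2)%R by lra.
apply: le_trans (Hk y (d / 2)%R _ d20 _ ynonfull) _.
  by rewrite t1 andbT mulr_gt0.
have cd0 : (0 < c * d)%R by rewrite mulr_gt0.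
have -> : (k * 2 `^ s * k' * t `^ s = k * (2 * t) `^ s * k')%R.
  by rewrite powRM ?ltW//; ring.
rewrite [in leRHS]EFinM -muleA lee_wpmul2l//.
  by rewrite lee_fin mulr_ge0 ?powR_ge0// ltW.
exact: le_trans (le_outer_measure _ _ _ xy) (Hk' _ _ cd0).
Qed.

End Doubling.

(** * Positive measure of thick sets *)

Theorem theorem3p2 (R : realType) (X : metricType R)
    (alpha : R^nat) (E : set X) :
  uniformly_perfect X -> ell0 alpha -> thick alpha E -> fat E.
Proof.
move=> upX al0 [N [c [K [I [J]]]]].
move=> [[N0 /andP[c0 c1] Kn0 IJ] [E0b IN Jle Ix E0E]] mu muR mudbl.
have [s [k [s0 k0 small]]] := small_subset_measure mu mudbl
  (fun x r => muR.1 _ (borel_set_cball x r)) upX _ c0.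
(* The exponent [s] depends on [mu], hence the assumption on all powers of [alpha]. *)
have [al01 als] := al0 s s0.
have al_gt0 n : 0 < alpha n by case/andP: (al01 n).
have al_ge0 n : 0 <= alpha n `^ s by exact: powR_ge0.
set E0 := \bigcup_n \bigcup_(j in K n) I n j in E0b E0E.
set F := fun n => \bigcup_(j in K n) J n j.
set A := fun n => E0 `\` \bigcup_(k < n) F k.
set b := k * (c^-1 `^ s) * N%:R.
have b0 : 0 < b by rewrite !mulr_gt0// ?powR_gt0 ?invr_gt0// ltr0n.
(* The balls of step [m] avoid every [J k i] with [k < m], in particular with [k < n], so they lie
   in [A n]. The bound on [alpha m] is [2 * t <= 1] for [t = alpha m / c]. *)
have FA n m : (n <= m)%N -> alpha m <= c / 2 ->
    (mu (F m) <= (b * alpha m `^ s)%:E * mu (A n))%E.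
  move=> nm alc.
  have Bex j : exists B : set X, [/\ mu.-caratheodory B, B `<=` A n,
      B `<=` [set x | K m j /\ I m j x] &
      (mu [set x | K m j /\ J m j x] <=
        (k * (alpha m / c) `^ s)%:E * mu B)%E].
    have [Kj|nKj] := pselect (K m j); last first.
      (* Indices outside [K m] get empty sets, so that the families run over all of [nat]. *)
      exists set0; split=> //; first exact: caratheodory_measurable_set0.
      rewrite (_ : [set x | _ /\ _] = set0) ?outer_measure0 ?mule0//.
      by rewrite -subset0 => x [].
    have [_ _ JI] := IJ _ _ Kj.
    have [d0 [x [Ixx xI]]] := Ix _ _ Kj.
    exists (cball x (c * diam (I m j))); split.
    - exact: muR.1 (borel_set_cball _ _).
    - move=> y /xI [Iy Jy]; split; first by exists m => //; exists j.
      by move=> [i /= ilt [l Kl Jl]]; apply: Jy; exists i;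
        [exact: leq_trans nm | exists l].
    - by move=> y /xI [Iy _].
    - rewrite (_ : [set x | _ /\ _] = J m j); last first.
        by apply/seteqP; split => [y []|y].
      apply: small => //.
      + have [M HM] := E0b; exists M => u v Iu Iv.
        by apply: HM; exists m => //; exists j.
      + by rewrite pmulr_rgt0 in d0.
      + by rewrite divr_gt0.
      + by rewrite mulrA ler_pdivrMr// mul1r mulrC -ler_pdivlMr.
      + by rewrite mulrAC ler_pdivlMr// mulrC Jle.
  have [B HB] := choice Bex.
  have -> : F m = \bigcup_j [set x | K m j /\ J m j x].
    by apply/seteqP; split => [x [j Kj Jj]|x [j _ [Kj Jj]]]; exists j.
  have -> : b * alpha m `^ s = k * (alpha m / c) `^ s * N%:R.
    by rewrite powRM ?invr_ge0 ?ltW// /b; ring.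
  apply: (le_outer_measure_bigcup_overlap _ _ B).
  - by rewrite mulr_ge0 ?powR_ge0// ltW.
  - by move=> j; case: (HB j).
  - move=> x; apply: card_le_trans (IN m x); apply: subset_card_le => j.
    by case: (HB j) => _ _ + _ => /[apply].
have [n [nc ntail]] : exists n, (forall m, (n <= m)%N -> alpha m <= c / 2) /\
    (\sum_(n <= i <oo) (alpha i `^ s)%:E < (2 * b)^-1%:E)%E.
  (* Since [s > 0], [alpha m <= c / 2] follows from comparing [s]-th powers. *)
  have cs0 : 0 < (c / 2) `^ s by apply/powR_gt0/divr_gt0.
  have [n1 _ Hn1] := nneseries_near_lt _ _ al_ge0 als cs0.
  have b20 : 0 < (2 * b)^-1 by rewrite invr_gt0 mulr_gt0.
  have [n2 _ Hn2] := nneseries_tail_lt _ _ al_ge0 als b20.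
  exists (maxn n1 n2); split; last by apply: Hn2; rewrite /= leq_maxr.
  move=> m; rewrite geq_max => /andP[/Hn1 /= h _].
  rewrite leNgt; apply/negP => cm; move: h; apply/negP; rewrite -leNgt.
  by rewrite ge0_ler_powR ?nnegrE ?divr_ge0 ?ltW.
have A0 : (0 < mu (A n))%E.
  have [j Kj] := Kn0 n; have [d0 [x [Ixx xI]]] := Ix _ _ Kj.
  apply: lt_le_trans (doubling_gt0 mu mudbl x _ d0) _; apply: le_outer_measure.
  by move=> y /xI [Iy Jy]; split=> //; exists n => //; exists j.
have Afin : mu (A n) \is a fin_num.
  have [x Ax] : A n !=set0.
    by apply/set0P; apply: contraTneq A0 => ->; rewrite outer_measure0 ltxx.
  have [M HM] := E0b.
  rewrite ge0_fin_numE ?outer_measure_ge0//.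
  apply: (@le_lt_trans _ _ (mu (cball x M))); last first.
    by rewrite -ge0_fin_numE ?outer_measure_ge0//; exact: doubling_fin_num.
  by apply: le_outer_measure => y [Ay _]; apply: HM => //; case: Ax.
rewrite lt_neqAle outer_measure_ge0 andbT; apply/eqP => muE0.
(* A point of [A n] avoids [F k] for [k < n], so by (v) it is in [E] or in a later [F]. *)
have AEF : A n `<=` E `|` \bigcup_i F (i + n)%N.
  move=> x [E0x Fx]; have [[i _ Fi]|nF] := pselect ((\bigcup_i F i) x).
    right; exists (i - n)%N => //; rewrite subnK// leqNgt; apply/negP => ilt.
    by apply: Fx; exists i.
  by left; apply: E0E.
(* The bounds [FA] sum to at most [b * mu (A n)] times the tail, which is below [(2 * b)^-1]. This
   is absurd as [mu (A n)] is positive and finite. *)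
have : (mu (A n) <= (fine (mu (A n)) / 2)%:E)%E.
  apply: le_trans (le_outer_measure _ _ _ AEF) _.
  apply: le_trans (outer_measureU2 _ _ _) _.
  rewrite -muE0 add0e.
  apply: le_trans (outer_measure_sigma_subadditive mu _) _.
  apply: (@le_trans _ _ (\sum_(0 <= i <oo)
      (b * fine (mu (A n)))%:E * (alpha (i + n)%N `^ s)%:E)%E).
    apply: lee_nneseries => [i _ _|i _]; first exact: outer_measure_ge0.
    apply: le_trans (FA n _ (leq_addl _ _) (nc _ (leq_addl _ _))) _.
    by rewrite -[X in (_ * X <= _)%E]fineK// -!EFinM lee_fin mulrAC.
  rewrite nneseriesZl; last by move=> i _; rewrite lee_fin.
  rewrite (nneseries_addn n (f := fun i => (alpha i `^ s)%:E)); last first.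
    by move=> i; rewrite lee_fin.
  apply: le_trans (lee_wpmul2l _ (ltW ntail)) _.
    by rewrite lee_fin mulr_ge0 ?fine_ge0 ?outer_measure_ge0// ltW.
  rewrite -EFinM lee_fin le_eqVlt; apply/orP; left; apply/eqP.
  by field; rewrite gt_eqF.
rewrite -[leLHS]fineK// lee_fin; move: A0; rewrite -[ltRHS]fineK// lte_fin.
by lra.
Qed.
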